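(* Let $X$ be a nonnegative random variable with probability density function $g$, let $f:\mathbb{R}_+\to\mathbb{R}_+$ be increasing (in the sense of non-decreasing), and let $w(\lambda,x)$ be a $\mathrm{TP}_3$ weight function. Suppose that $w(\lambda,x)$ is differentiable in $\lambda$, that its partial derivative $\partial w(\lambda,x)/\partial\lambda$ is integrable, and that $H_1[\lambda,f(X)]:=\frac{\partial}{\partial\lambda}H[\lambda,f(X)]$ exists. Put $$\mu_\lambda=H[\lambda,f(X)],\qquad \sigma_\lambda^2=H[\lambda,(f(X))^2]-(H[\lambda,f(X)])^2,\qquad \mathrm{VMR}_\lambda=\sigma_\lambda^2/\mu_\lambda .$$ Then $$\frac{\partial}{\partial\lambda}\log\frac{H[\lambda,(f(X))^2]}{H[\lambda,f(X)]}\ge 0,$$ so that the function $$\lambda\mapsto \frac{H[\lambda,(f(X))^2]}{H[\lambda,f(X)]}=\mathrm{VMR}_\lambda+\mu_\lambda$$ is increasing (non-decreasing). Thus both $\mu_\lambda$ and $\mathrm{VMR}_\lambda+\mu_\lambda$ are increasing (non-decreasing) functions of $\lambda$.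
   Context: A weight function is a nonnegative function $w(\lambda,x)$ depending on a loading parameter $\lambda>0$, Borel-measurable in $x$ for each $\lambda$. It is $\mathrm{TP}_3$ (totally positive of order 3) if for every $r=1,2,3$, all $\lambda_1>\cdots>\lambda_r$ and all $x_1>\cdots>x_r$, the $r\times r$ determinant $\det(w(\lambda_i,x_j))$ is $\ge 0$. For $h:\mathbb{R}_+\to\mathbb{R}_+$, the generalized weighted premium is $H[\lambda,h(X)]=\mathbb{E}[w(\lambda,X)h(X)]/\mathbb{E}[w(\lambda,X)]$, whenever these expectations exist; all integrals are assumed to converge absolutely. If $Y$ has the weighted density $w(\lambda,y)g(y)/\mathbb{E}[w(\lambda,X)]$, $y\ge 0$, then $\mu_\lambda$ and $\sigma^2_\lambda$ are the mean and variance of $f(Y)$, and $\mathrm{VMR}_\lambda$ is the variance-to-mean ratio (index of dispersion).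
   Formalization: The inequality for the derivative of log(H[λ,f(X)²]/H[λ,f(X)]) is proved at every λ where H[λ,f(X)]>0 and H[·,f(X)²] is differentiable; the stated hypotheses do not guarantee that this derivative exists. The monotonicity claims are unconditional. *)

(* Defs.v *)
From HB Require Import structures.
From mathcomp Require Import all_boot all_order all_algebra.
From mathcomp Require Import all_classical all_reals all_analysis.
Set Implicit Arguments.
Unset Strict Implicit.
Unset Printing Implicit Defensive.
Import Order.TTheory GRing.Theory Num.Theory.
Import numFieldNormedType.Exports.
Local Open Scope classical_set_scope.
Local Open Scope ring_scope.

(* A function on R_+ (or a weight on ]0, +oo[ * R_+) is represented by a total
   function on R; only its values at arguments 0 <= x (and 0 < l) matter. *)

Definition weight_function (R : realType) (w : R -> R -> R) : Prop :=
  forall l : R, 0 < l ->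
    (forall x : R, 0 <= x -> 0 <= w l x) /\
    measurable_fun (`[0, +oo[ : set R) (w l).

(* Listing both families of arguments increasingly instead of decreasingly
   would reverse the rows and the columns and give the same determinants. *)
Definition totally_positive (R : realType) (k : nat) (w : R -> R -> R) : Prop :=
  forall r : nat, (1 <= r <= k)%N ->
  forall l x : 'I_r -> R,
    (forall i, 0 < l i) -> (forall i, 0 <= x i) ->
    (forall i j : 'I_r, (i < j)%N -> l j < l i) ->
    (forall i j : 'I_r, (i < j)%N -> x j < x i) ->
    0 <= \det (\matrix_(i < r, j < r) w (l i) (x j)).

Definition is_density (R : realType) (d : measure_display)
    (T : measurableType d) (P : probability T R) (X : {RV P >-> R})
    (g : R -> R) : Prop :=
  [/\ measurable_fun setT g,
      (forall x, 0 <= g x) &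
      forall A : set R, measurable A ->
        distribution P X A = (\int[lebesgue_measure]_(x in A) (g x)%:E)%E].

Section WeightedPremium.
Context (R : realType) (d : measure_display) (T : measurableType d).
Variables (P : probability T R) (X : T -> R) (w : R -> R -> R).

(* The generalized weighted premium H[l, h(X)]. *)
Definition premium (h : R -> R) (l : R) : R :=
  fine ('E_P[fun t => (w l (X t) * h (X t))%R])%E /
  fine ('E_P[fun t => w l (X t)])%E.

Variable f : R -> R.

Definition wmean (l : R) : R := premium f l.

Definition wvar (l : R) : R :=
  premium (fun x => f x ^+ 2) l - premium f l ^+ 2.

Definition VMR (l : R) : R := wvar l / wmean l.

Definition premium_ratio (l : R) : R :=
  premium (fun x => f x ^+ 2) l / premium f l.

End WeightedPremium.

Definition nondecreasing_pos (R : realType) (F : R -> R) : Prop :=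
  forall a b : R, 0 < a -> a <= b -> F a <= F b.

(* Main.v *)
(* Write E_k(l) = E[w(l, X) f(X)^k], so that the premiums of f and f^2 are
   E_1/E_0 and E_2/E_1 is their ratio.  For a < b, the 2x2 minors of w and the
   monotonicity of f give
     (w(b,x) w(a,y) - w(a,x) w(b,y)) (f(x) - f(y)) >= 0,
   and integrating this over x and y, without or with the factor f(x) f(y),
   gives E_1(b) E_0(a) >= E_0(b) E_1(a) and E_2(b) E_1(a) >= E_1(b) E_2(a).
   The derivative of the logarithm of E_2/E_1 is then nonnegative as a limit of
   nonnegative right difference quotients. *)
Require Import Defs.
From HB Require Import structures.
From mathcomp Require Import all_boot all_order all_algebra.
From mathcomp Require Import all_classical all_reals all_analysis.
From mathcomp Require Import ring lra.
Import Order.TTheory GRing.Theory Num.Theory.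
Import numFieldNormedType.Exports.
Local Open Scope classical_set_scope.
Local Open Scope ring_scope.

Set Implicit Arguments.
Unset Strict Implicit.

Section Chebyshev.
Context (d : measure_display) (T : measurableType d) (R : realType).
Variable mu : {measure set T -> \bar R}.

Lemma integrable_comb (a b : R) (u v : T -> R) :
  mu.-integrable setT (EFin \o u) -> mu.-integrable setT (EFin \o v) ->
  mu.-integrable setT (EFin \o (fun t => a * u t + b * v t)).
Proof.
move=> iu iv.
have -> : EFin \o (fun t => a * u t + b * v t) =
    (fun t => a%:E * (EFin \o u) t + b%:E * (EFin \o v) t)%E.
  by apply/funext => t /=; rewrite EFinD !EFinM.
by apply: integrableD => //; exact: integrableZl.
Qed.

Lemma Rintegral_comb (a b : R) (u v : T -> R) :
  mu.-integrable setT (EFin \o u) -> mu.-integrable setT (EFin \o v) ->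
  \int[mu]_t (a * u t + b * v t) =
  a * \int[mu]_t u t + b * \int[mu]_t v t.
Proof.
move=> iu iv; rewrite RintegralD ?RintegralZl//.
- by have := integrableZl measurableT a iu.
- by have := integrableZl measurableT b iv.
Qed.

(* The hypothesis is integrated in [s], then in [t]; each time the integrand is
   a finite linear combination, so that no product measure is needed. *)
Lemma chebyshev_integral (p q F : T -> R) :
  mu.-integrable setT (EFin \o p) -> mu.-integrable setT (EFin \o q) ->
  mu.-integrable setT (EFin \o (p \* F)) ->
  mu.-integrable setT (EFin \o (q \* F)) ->
  (forall s t, 0 <= (p s * q t - q s * p t) * (F s - F t)) ->
  \int[mu]_t p t * \int[mu]_t (q t * F t) <=
  \int[mu]_t (p t * F t) * \int[mu]_t q t.
Proof.
move=> ip iq ipF iqF pqF.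
pose Ip := \int[mu]_t p t; pose Iq := \int[mu]_t q t.
pose IpF := \int[mu]_t (p \* F) t; pose IqF := \int[mu]_t (q \* F) t.
(* This is the hypothesis expanded and integrated in [s] at fixed [t]. The factors [1 *] keep the
   shape of two nested linear combinations, so that [Rintegral_comb] applies at each level. *)
have inner t : 0 <= 1 * (IpF * q t + - IqF * p t) +
                    1 * (Iq * (p \* F) t + - Ip * (q \* F) t).
  have -> : 1 * (IpF * q t + - IqF * p t) +
            1 * (Iq * (p \* F) t + - Ip * (q \* F) t) =
      \int[mu]_s (1 * (q t * (p \* F) s + - p t * (q \* F) s) +
                  1 * ((p \* F) t * q s + - (q \* F) t * p s)).
    rewrite Rintegral_comb; [|exact: integrable_comb..].
    by rewrite !Rintegral_comb// -/Ip -/Iq -/IpF -/IqF; ring.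
  apply: Rintegral_ge0 => s _.
  by have := pqF s t; congr (_ <= _) => /=; ring.
have : 0 <= \int[mu]_t (1 * (IpF * q t + - IqF * p t) +
                        1 * (Iq * (p \* F) t + - Ip * (q \* F) t)).
  by apply: Rintegral_ge0 => t _; exact: inner.
rewrite Rintegral_comb; [|exact: integrable_comb..].
rewrite !Rintegral_comb// -/Ip -/Iq -/IpF -/IqF.
(* By symmetry in [s] and [t], each product occurs twice: [outer] says that 2 (IpF Iq - Ip IqF) is
   nonnegative. *)
by move=> outer; change (Ip * IqF <= IpF * Iq); nra.
Qed.

End Chebyshev.

Section DeriveSign.
Context (R : realType).

(** The derivative is also the limit from the right alone, so comparisons with points above [l]
    suffice and the domain to the left of [l] never enters. *)
Lemma derive1_ge0_right (F : R -> R) (l : R) : derivable F l 1 ->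
  (forall m, l <= m -> F l <= F m) -> 0 <= derive1 F l.
Proof.
move=> dF Fl; rewrite derive1E.
have dF' : h^-1 *: (F (h *: 1 + l) - F l) @[h --> 0^'+] --> 'D_1 F l.
  exact: cvg_dnbhs_at_right.
apply: (cvgr_to_ge dF').
near=> h.
have h0 : 0 < h by near: h; exact: nbhs_right_gt.
apply: mulr_ge0; first by rewrite invr_ge0 ltW.
by rewrite subr_ge0 Fl// lerDr /GRing.scale/= mulr1 ltW.
Unshelve. all: by end_near. Qed.

End DeriveSign.

Lemma TP2_minor (R : realType) (k : nat) (w : R -> R -> R) (a b x y : R) :
  (2 <= k)%N -> totally_positive k w -> 0 < a -> a < b -> 0 <= y -> y < x ->
  w b y * w a x <= w b x * w a y.
Proof.
move=> k2 tp a0 ab y0 yx.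
(* Total positivity lists arguments decreasingly, so index 0 carries the larger ones, [b] and
   [x]. *)
have := tp 2%N k2 (fun i => if i == ord0 then b else a)
  (fun i => if i == ord0 then x else y).
rewrite (expand_det_row _ ord0) !big_ord_recl big_ord0 /cofactor !det_mx11.
rewrite !mxE /= expr0 expr1 => H.
suff : 0 <= w b x * w a y - w b y * w a x by rewrite subr_ge0.
have -> : w b x * w a y - w b y * w a x =
  w b x * (1 * w a y) + (w b y * (-1 * w a x) + 0) by ring.
apply: H.
- by move=> i; case: ifP => // _; exact: lt_trans ab.
- by move=> i; case: ifP => // _; exact: le_trans (ltW yx).
- by case=> [[|[|//]]] hi [[|[|//]]] hj.
- by case=> [[|[|//]]] hi [[|[|//]]] hj.
Qed.

(** Exchanging [x] and [y] changes the sign of both factors, so they always agree in sign. This is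
    the pointwise hypothesis of [chebyshev_integral]. *)
Lemma TP2_minor_mono (R : realType) (k : nat) (w : R -> R -> R) (f : R -> R)
    (a b x y : R) :
  (2 <= k)%N -> totally_positive k w ->
  (forall x y, 0 <= x -> x <= y -> f x <= f y) ->
  0 < a -> a < b -> 0 <= x -> 0 <= y ->
  0 <= (w b x * w a y - w a x * w b y) * (f x - f y).
Proof.
move=> k2 tp f_mono a0 ab x0 y0; have [xy|yx|->] := ltgtP x y.
- have minor := TP2_minor k2 tp a0 ab x0 xy; have fxy := f_mono _ _ x0 (ltW xy).
  by rewrite mulr_le0// subr_le0 // [leRHS]mulrC.
- have minor := TP2_minor k2 tp a0 ab y0 yx; have fyx := f_mono _ _ y0 (ltW yx).
  by rewrite mulr_ge0// subr_ge0 // mulrC.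
- by rewrite subrr mulr0.
Qed.

Lemma premiumE (R : realType) (d : measure_display) (T : measurableType d)
    (P : probability T R) (X : T -> R) (w : R -> R -> R) (h : R -> R) (l : R) :
  premium P X w h l =
  (\int[P]_t (w l (X t) * h (X t))) / (\int[P]_t w l (X t)).
Proof. by rewrite /premium unlock. Qed.

Unset Implicit Arguments.
Set Strict Implicit.

Theorem mainTheorem2 (R : realType) (d : measure_display)
    (T : measurableType d) (P : probability T R) (X : {RV P >-> R})
    (g f : R -> R) (w : R -> R -> R)
    (X_ge0 : forall t, 0 <= X t)
    (X_density : is_density X g)
    (f_ge0 : forall x, 0 <= x -> 0 <= f x)
    (f_mono : forall x y, 0 <= x -> x <= y -> f x <= f y)
    (w_weight : weight_function w)
    (w_TP3 : totally_positive 3 w)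
    (* all the expectations converge absolutely, and H is well defined *)
    (w_int : forall l, 0 < l ->
       P.-integrable setT (fun t => (w l (X t))%:E))
    (wf_int : forall l, 0 < l ->
       P.-integrable setT (fun t => (w l (X t) * f (X t))%:E))
    (wf2_int : forall l, 0 < l ->
       P.-integrable setT (fun t => (w l (X t) * f (X t) ^+ 2)%:E))
    (w_pos : forall l, 0 < l -> (0 < 'E_P[fun t => w l (X t)])%E)
    (w_diff : forall l x, 0 < l -> 0 <= x ->
       derivable (fun l' => w l' x) l 1)
    (dw_int : forall l, 0 < l ->
       P.-integrable setT
         (fun t => (derive1 (fun l' => w l' (X t)) l)%:E))
    (H1_exists : forall l, 0 < l -> derivable (premium P X w f) l 1) :
  (* where the logarithm and the derivative of H[l, f(X)^2] exist *)
  (forall l, 0 < l -> 0 < premium P X w f l ->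
     derivable (premium P X w (fun x => f x ^+ 2)) l 1 ->
     derivable (fun l' => ln (premium_ratio P X w f l')) l 1 /\
     0 <= derive1 (fun l' => ln (premium_ratio P X w f l')) l) /\
  (forall l, 0 < l ->
     premium_ratio P X w f l = VMR P X w f l + wmean P X w f l) /\
  nondecreasing_pos (premium_ratio P X w f) /\
  nondecreasing_pos (wmean P X w f) /\
  nondecreasing_pos (fun l => VMR P X w f l + wmean P X w f l).
Proof.
have w0 l t : 0 < l -> 0 <= w l (X t) by move=> l0; exact: (w_weight l l0).1.
have f0 t : 0 <= f (X t) by exact: f_ge0.
pose E0 l := \int[P]_t w l (X t).
pose E1 l := \int[P]_t (w l (X t) * f (X t)).
pose E2 l := \int[P]_t (w l (X t) * f (X t) ^+ 2).
have H1E l : premium P X w f l = E1 l / E0 l by rewrite premiumE.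
have H2E l : premium P X w (fun x => f x ^+ 2) l = E2 l / E0 l.
  by rewrite premiumE.
have E0_gt0 l : 0 < l -> 0 < E0 l.
  move=> l0; rewrite fine_gt0//.
  have := w_pos l l0; rewrite unlock => -> /=; rewrite ltey_eq.
  by rewrite (integrable_fin_num _ (w_int l l0)).
have E1_ge0 l : 0 < l -> 0 <= E1 l.
  by move=> l0; apply: Rintegral_ge0 => t _; rewrite mulr_ge0 ?w0.
have E2_ge0 l : 0 < l -> 0 <= E2 l.
  by move=> l0; apply: Rintegral_ge0 => t _; rewrite mulr_ge0 ?w0 ?sqr_ge0.
have wffE l : (fun t => (w l (X t) * f (X t)) * f (X t)) =
              (fun t => w l (X t) * f (X t) ^+ 2).
  by apply/funext => t; rewrite -mulrA expr2.
have wff_int l : 0 < l ->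
    P.-integrable setT (EFin \o (fun t => (w l (X t) * f (X t)) * f (X t))).
  by move=> l0; rewrite wffE; exact: wf2_int.
(* Cauchy-Schwarz for the weight [w l], as the case p = w f, q = w of the Chebyshev inequality; it
   serves to make [E2] positive where [E1] is. *)
have E1_sqr l : 0 < l -> E1 l * E1 l <= E2 l * E0 l.
  move=> l0; rewrite /E2 -wffE.
  apply: (chebyshev_integral (F := fun t => f (X t)) (wf_int l l0) (w_int l l0)
            (wff_int l l0) (wf_int l l0)) => s t.
  have -> : (w l (X s) * f (X s) * w l (X t) - w l (X s) * (w l (X t) * f (X t)))
      * (f (X s) - f (X t)) = w l (X s) * w l (X t) * (f (X s) - f (X t)) ^+ 2.
    by ring.
  by apply: mulr_ge0; [rewrite mulr_ge0 ?w0 | exact: sqr_ge0].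
have E1_cross a b : 0 < a -> a < b -> E0 b * E1 a <= E1 b * E0 a.
  move=> a0 ab; have b0 := lt_trans a0 ab.
  apply: (chebyshev_integral (F := fun t => f (X t)) (w_int b b0) (w_int a a0)
            (wf_int b b0) (wf_int a a0)) => s t.
  exact: (TP2_minor_mono (k := 3)).
have E2_cross a b : 0 < a -> a < b -> E1 b * E2 a <= E2 b * E1 a.
  move=> a0 ab; have b0 := lt_trans a0 ab; rewrite /E2 -!wffE.
  apply: (chebyshev_integral (F := fun t => f (X t)) (wf_int b b0) (wf_int a a0)
            (wff_int b b0) (wff_int a a0)) => s t.
  rewrite (_ : _ * _ = f (X s) * f (X t) *
    ((w b (X s) * w a (X t) - w a (X s) * w b (X t)) * (f (X s) - f (X t)))).
    by apply: mulr_ge0; [exact: mulr_ge0 | exact: (TP2_minor_mono (k := 3))].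
  by ring.
have ratioE l : 0 < l -> premium_ratio P X w f l = E2 l / E1 l.
  move=> l0; rewrite /premium_ratio H1E H2E invf_div mulrA divfK //.
  by rewrite gt_eqF // E0_gt0.
have mean_mono : nondecreasing_pos (wmean P X w f).
  move=> a b a0; rewrite le_eqVlt => /predU1P[-> //|ab].
  have b0 := lt_trans a0 ab.
  rewrite /wmean !H1E ler_pdivrMr ?E0_gt0// mulrAC ler_pdivlMr ?E0_gt0//.
  by rewrite mulrC; exact: E1_cross.
have ratio_mono : nondecreasing_pos (premium_ratio P X w f).
  move=> a b a0; rewrite le_eqVlt => /predU1P[-> //|ab].
  have b0 := lt_trans a0 ab; rewrite !ratioE//.
  (* If [E1 a] vanishes, the ratio at [a] is 0 by the convention for division by zero, and the ratio
     at [b] is nonnegative. Otherwise [E1_cross] carries positivity from [E1 a] to [E1 b]. *)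
  have := E1_ge0 a a0; rewrite le_eqVlt => /predU1P[<-|E1a].
    by rewrite invr0 mulr0 divr_ge0 ?E1_ge0 ?E2_ge0.
  have E1b : 0 < E1 b.
    rewrite -(pmulr_lgt0 _ (E0_gt0 a a0)).
    by apply: lt_le_trans (E1_cross a b a0 ab); rewrite mulr_gt0 ?E0_gt0.
  by rewrite ler_pdivrMr// mulrAC ler_pdivlMr// mulrC; exact: E2_cross.
have decomp l : 0 < l ->
    premium_ratio P X w f l = VMR P X w f l + wmean P X w f l.
  move=> l0; rewrite /premium_ratio /VMR /wvar /wmean.
  (* With a zero mean, the ratio and the VMR both take the default value 0. *)
  have [->|H1n0] := eqVneq (premium P X w f l) 0; first by rewrite !invr0 !mulr0 addr0.
  by field.
split; last first.
  split=> //; split=> //; split=> // a b a0 ab; rewrite -!decomp ?(lt_le_trans a0 ab)//.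
  exact: ratio_mono.
move=> l l0 H1_gt0 dH2.
have E1_gt0 : 0 < E1 l by move: H1_gt0; rewrite H1E pmulr_lgt0 // invr_gt0 E0_gt0.
(* The logarithm is differentiable only at a positive ratio, hence the need for strict
   positivity. *)
have E2_gt0 : 0 < E2 l.
  rewrite -(pmulr_lgt0 _ (E0_gt0 l l0)).
  by apply: lt_le_trans (E1_sqr l l0); rewrite mulr_gt0.
have ratio_gt0 : 0 < premium_ratio P X w f l by rewrite ratioE// divr_gt0.
have d_ratio : derivable (premium_ratio P X w f) l 1.
  apply: derivableM => //.
  by apply: derivableV; [rewrite gt_eqF | exact: H1_exists].
have d_ln : derivable (fun l' => ln (premium_ratio P X w f l')) l 1.
  apply/derivable1_diffP.
  apply: (@differentiable_comp _ _ _ _ (premium_ratio P X w f) (@ln R)).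
    exact/derivable1_diffP.
  by apply/derivable1_diffP; have [] := is_derive1_ln ratio_gt0.
split=> //; apply: derive1_ge0_right => // m lm.
(* This also makes the ratio at [m] positive, as comparing logarithms requires. *)
have le_lm := ratio_mono l m l0 lm.
by rewrite ler_ln ?posrE// (lt_le_trans ratio_gt0).
Qed.
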